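(* Let $s \ge 1$ and $d > 2s$ be integers, let $e_i$ denote the $i$th standard basis vector of $\mathbb{R}^d$, and let $S = \left\{\sum_{i = 1}^{s} e_i,\ \sum_{i = s+1}^{2s} e_i,\ 0 \right\}$. Let $C > 0$ and let $f: S \rightarrow \mathbb{R}^m$ be an arbitrary mapping satisfying \[ \|f(x) - f(y)\|_{\infty} \le \|x-y\|_{\infty} \quad \text{for all } x,y \in S,\] \[ C \|x-y\|_{1} \le \|f(x) - f(y)\|_{1} \quad \text{for all } x,y \in S.\] Then $m \ge Cs$. *)

(* Defs.v *)
From HB Require Import structures.
From mathcomp Require Import all_boot all_order all_algebra.
From mathcomp Require Import all_classical all_reals all_analysis.
Import Order.TTheory GRing.Theory Num.Theory.
Import numFieldNormedType.Exports.

Set Implicit Arguments.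
Unset Strict Implicit.
Unset Printing Implicit Defensive.

Local Open Scope classical_set_scope.
Local Open Scope ring_scope.

(* R^n is 'rV[R]_n. The library norm `|x| on 'rV[R]_n is the l_infinity norm
   (see mx_normrE); only the l_1 norm has to be introduced. *)
Definition l1norm (R : realType) (n : nat) (x : 'rV[R]_n) : R :=
  \sum_(i < n) `|x 0 i|.

(* The points e_1 + ... + e_s, e_(s+1) + ... + e_(2s) and 0. Coordinates are
   numbered from 0, so the (i+1)-st basis vector is 'e_i = delta_mx 0 i. *)
Definition three_points (R : realType) (d s : nat) : set 'rV[R]_d :=
  [set \sum_(i < d | (i < s)%N) 'e_i;
       \sum_(i < d | (s <= i < 2 * s)%N) 'e_i;
       0].

Arguments three_points : clear implicits.

(* Main.v *)
Require Import Defs.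
From HB Require Import structures.
From mathcomp Require Import all_boot all_order all_algebra.
From mathcomp Require Import all_classical all_reals all_analysis.
Import Order.TTheory GRing.Theory Num.Theory.
Import numFieldNormedType.Exports.
Local Open Scope classical_set_scope.
Local Open Scope ring_scope.

(** Compare the two norms on the pair [u], [0], where [u] is the sum of the first [s] basis vectors.
    Since [u] is a 0/1 vector with exactly [s] ones, its l_1 norm is [s] ([l1norm_sum_delta_mx])
    while its l_infinity norm is at most 1 ([mx_norm_sum_delta_mx]). In dimension [m] the l_1 norm
    is at most [m] times the l_infinity norm ([l1norm_le_mx_norm]). Writing [D] for [f u - f 0],
    this gives [C * s <= |D|_1 <= m * |D|_oo <= m * |u|_oo <= m]. *)

Lemma l1norm_le_mx_norm (R : realType) (n : nat) (x : 'rV[R]_n) :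
  l1norm x <= n%:R * `|x|.
Proof.
(* The right-hand side becomes a constant sum over ['I_n], so that the sums compare term by term. *)
rewrite mulr_natl -[X in _ *+ X]card_ord -sumr_const; apply: ler_sum => i _.
by rewrite [leRHS]mx_normrE; apply: (le_bigmax _ _ (0, i)).
Qed.

Lemma sum_delta_mxE (R : realType) (d s : nat) (j : 'I_d) :
  (\sum_(i < d | (i < s)%N) 'e_i : 'rV[R]_d) 0 j = (j < s)%:R.
Proof.
rewrite summxE; under eq_bigr do rewrite mxE eqxx /=.
(* Only the summand [i = j] can be nonzero at coordinate [j]. *)
rewrite big_mkcond (bigD1 j) //= eqxx big1 ?addr0; first by case: (j < s)%N.
by move=> i; rewrite eq_sym => /negPf ->; case: ifP.
Qed.

Lemma l1norm_sum_delta_mx (R : realType) (d s : nat) : (s <= d)%N ->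
  l1norm (\sum_(i < d | (i < s)%N) 'e_i : 'rV[R]_d) = s%:R.
Proof.
move=> sd; rewrite /l1norm.
under eq_bigr do rewrite sum_delta_mxE normr_nat.
by rewrite -natr_sum -big_mkcond -(big_ord_widen _ (fun=> 1%N)) // sum1_card card_ord.
Qed.

(** Every entry is 0 or 1. An inequality rather than an equality also covers [s = 0], where the
    vector vanishes. *)
Lemma mx_norm_sum_delta_mx (R : realType) (d s : nat) :
  `|\sum_(i < d | (i < s)%N) 'e_i : 'rV[R]_d| <= 1.
Proof.
rewrite [leLHS]mx_normrE; apply/bigmax_leP; split => // -[i j] _ /=.
by rewrite ord1 sum_delta_mxE normr_nat lern1 leq_b1.
Qed.

Theorem mainTheorem13 (R : realType) (s d m : nat) (C : R)
    (f : three_points R d s -> 'rV[R]_m) :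
  (1 <= s)%N -> (2 * s < d)%N -> 0 < C ->
  (forall x y : three_points R d s,
     `|f x - f y| <= `|\val x - \val y|) ->
  (forall x y : three_points R d s,
     C * l1norm (\val x - \val y) <= l1norm (f x - f y)) ->
  C * s%:R <= m%:R.
Proof.
move=> _ sd _ f_lip f_expand.
set u : 'rV[R]_d := \sum_(i < d | (i < s)%N) 'e_i.
have Su : u \in three_points R d s by apply/mem_set; left; left.
have S0 : 0 \in three_points R d s by apply/mem_set; right.
have := f_expand (SigSub Su) (SigSub S0).
rewrite /= subr0 l1norm_sum_delta_mx; last first.
  (* All [s] ones fit among the [d] coordinates, as [s <= 2 * s < d]. *)
  by apply: leq_trans (ltnW sd); rewrite leq_pmull.
move=> /le_trans; apply; apply: le_trans (l1norm_le_mx_norm _ _ _) _.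
rewrite -[leRHS]mulr1 ler_wpM2l //.
apply: le_trans (f_lip _ _) _.
by rewrite /= subr0 mx_norm_sum_delta_mx.
Qed.
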